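(* For every $\delta>0$ and every $k\in\mathbb{N}$ there is $N_0<\infty$ such that the following holds. Let $G$ be a compact metrizable group with $|G|\geq N_0$ (this includes every infinite compact metrizable group), and let $E\subseteq G^k$ be a Borel set with $m_{G^k}(E)\geq\delta$, where $m_{G^k}$ is the Haar probability measure on $G^k$. Then there exist $(x_1,\ldots,x_k)\in G^k$ and $g\in G\setminus\{e\}$ such that \[E\supseteq\{(x_1^{\eta_1},\ldots,x_k^{\eta_k}):\ (\eta_1,\ldots,\eta_k)\in\{0,1\}^k\},\] where for each $i\leq k$ we set $x_i^0:=x_i$ and $x_i^1:=gx_i$.
   Context: $e$ denotes the identity of $G$. $|G|$ denotes the cardinality of $G$. *)

(* Defs.v *)
From HB Require Import structures.
From mathcomp Require Import all_boot all_order all_algebra.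
From mathcomp Require Import all_classical all_reals all_analysis.

Set Implicit Arguments.
Unset Strict Implicit.
Unset Printing Implicit Defensive.

Import Order.TTheory GRing.Theory Num.Theory.

Local Open Scope classical_set_scope.
Local Open Scope group_scope.

HB.mixin Record isTopologicalGroup G & Topological G & Group G := {
  mulg_continuous : continuous (fun x : G * G => x.1 * x.2) ;
  invg_continuous : continuous (fun x : G => x^-1)
}.

#[short(type="topologicalGroupType")]
HB.structure Definition TopologicalGroup :=
  {G of Topological G & Group G & isTopologicalGroup G}.

(* The topology of T is induced by some R-valued metric d; the axioms on d are
   those of the factory isMetric, from which 0 <= d x y follows. *)
Definition metrizable (R : realType) (T : topologicalType) : Prop :=
  exists d : T -> T -> R,
    [/\ forall x, d x x = 0%R,
        forall x y, d x y = 0%R -> x = y,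
        forall x y, d x y = d y x,
        forall y x z, (d x z <= d x y + d y z)%R
      & forall (x : T) (A : set T),
          nbhs x A <->
          exists2 e : R, (0 < e)%R & [set y | (d x y < e)%R] `<=` A].

Definition group_power (G : topologicalGroupType) (k : nat) : Type :=
  {ptws 'I_k -> G}.

Section group_power.
Variables (G : topologicalGroupType) (k : nat).
Local Notation Gk := (group_power G k).

HB.instance Definition _ := Topological.copy Gk {ptws 'I_k -> G}.

Definition group_power_mul (x y : Gk) : Gk := fun i => x i * y i.
Definition group_power_one : Gk := fun=> 1.
Definition group_power_inv (x : Gk) : Gk := fun i => (x i)^-1.

Lemma group_power_mulA : associative group_power_mul.
Proof. by move=> x y z; apply/funext => i; exact: mulgA. Qed.

Lemma group_power_mul1g : left_id group_power_one group_power_mul.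
Proof. by move=> x; apply/funext => i; exact: mul1g. Qed.

Lemma group_power_mulg1 : right_id group_power_one group_power_mul.
Proof. by move=> x; apply/funext => i; exact: mulg1. Qed.

Lemma group_power_mulVg :
  left_inverse group_power_one group_power_inv group_power_mul.
Proof. by move=> x; apply/funext => i; exact: mulVg. Qed.

Lemma group_power_mulgV :
  right_inverse group_power_one group_power_inv group_power_mul.
Proof. by move=> x; apply/funext => i; exact: mulgV. Qed.

HB.instance Definition _ := isGroup.Build Gk group_power_mulA
  group_power_mul1g group_power_mulg1 group_power_mulVg group_power_mulgV.

Lemma group_power_coord_continuous (i : 'I_k) : continuous (fun x : Gk => x i).
Proof. exact: (@proj_continuous _ (fun=> G) i). Qed.

Lemma group_power_continuous (T : topologicalType) (f : T -> Gk) :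
  (forall i, continuous (fun t => f t i)) -> continuous f.
Proof.
move=> cf t; apply/cvg_sup => i; apply/cvg_image; first last.
  by move=> A /(cf i t) fA; exists (fun x : Gk => A (x i)); [exact: fA|];
     apply/seteqP; split => [y [x Ax <-]//|y Ay]; exists (fun=> y).
by apply/seteqP; split => // y _; exists (fun=> y).
Qed.

Lemma group_power_mul_continuous : continuous (fun x : Gk * Gk => x.1 * x.2).
Proof.
apply: group_power_continuous => i x.
apply: (@cvg_comp _ _ _ (fun z : Gk * Gk => (z.1 i, z.2 i))
  (fun z : G * G => z.1 * z.2) _ (nbhs (x.1 i, x.2 i))); last first.
  exact: (@mulg_continuous G (x.1 i, x.2 i)).
have ci := @group_power_coord_continuous i.
apply: cvg_pair => /=.
  by apply: (@cvg_comp _ _ _ fst (fun y : Gk => y i)); [exact: cvg_fst|exact: ci].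
by apply: (@cvg_comp _ _ _ snd (fun y : Gk => y i)); [exact: cvg_snd|exact: ci].
Qed.

Lemma group_power_inv_continuous : continuous (fun x : Gk => x^-1).
Proof.
apply: group_power_continuous => i x.
exact: (cvg_comp _ _ (@group_power_coord_continuous i x) (@invg_continuous G (x i))).
Qed.

HB.instance Definition _ :=
  isTopologicalGroup.Build Gk
  group_power_mul_continuous group_power_inv_continuous.

End group_power.

(* measurableType's are pointed; this alias points a group at its identity. *)
Definition pointed_group (G : topologicalGroupType) : Type := G.

HB.instance Definition _ (G : topologicalGroupType) :=
  TopologicalGroup.on (pointed_group G).
HB.instance Definition _ (G : topologicalGroupType) :=
  isPointed.Build (pointed_group G) (1 : G).

Notation borel G := (g_sigma_algebraType (@open (pointed_group G))).

(* On a compact metrizable group every Borel probability measure is regular, so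
   left invariance alone singles out the Haar probability measure. *)
Definition haar (R : realType) (G : topologicalGroupType)
    (m : probability (borel G) R) : Prop :=
  forall (a : G) (A : set (borel G)), measurable A ->
    m ((fun x : G => a * x) @` A) = m A.

(* Main.v *)
(* If G is infinite, the identity e is not isolated, and translation is continuous
   in measure: for a sequence g_n -> e with g_n <> e, the points x of E for which
   some vertex of the cube (x, g_n) lies outside E form a set whose measure tends
   to 0, hence has measure less than that of E for large n.

   If G is finite and large, it contains a large abelian subgroup (a self-centralizing
   normal abelian subgroup of a Sylow subgroup, or an element of large prime order),
   hence commuting elements g_j, j in I, such that no product over a nonempty subset
   S of I is e. Mapping a word w over the alphabet {0,1}^k to the point of G^k with
   coordinates h_i = prod_(j : w_j(i) = 1) g_j sends combinatorial lines to cubes,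
   with g the product of the g_j over the wildcard set. After averaging over
   translations this reduces the theorem to the density Hales-Jewett theorem.

   The latter is proved by density increment, following Polymath and
   Dodos-Kanellopoulos-Tyros, by induction on the number of classes of a
   partition of a fixed alphabet. *)
Require Import Defs.
From HB Require Import structures.
From mathcomp Require Import all_boot all_order all_algebra all_fingroup all_solvable finmap.
From mathcomp Require Import all_classical all_reals all_analysis measurable_realfun.
From mathcomp Require Import ring lra.

Set Implicit Arguments.
Unset Strict Implicit.
Unset Printing Implicit Defensive.

Import Order.TTheory GRing.Theory Num.Theory.

Local Open Scope ring_scope.

(** * Averages, words and subspaces *)

Section Average.
Variable R : realFieldType.

Definition avg (T : finType) (f : T -> R) : R := (\sum_x f x) / #|T|%:R.

Definition dens (T : finType) (A : T -> bool) : R := avg (fun x => (A x)%:R).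

Variable T : finType.
Implicit Types f g : T -> R.

Lemma eq_avg f g : f =1 g -> avg f = avg g.
Proof. by move=> fg; rewrite /avg (eq_bigr g) // => x _; exact: fg. Qed.

Lemma avgD f g : avg (fun x => f x + g x) = avg f + avg g.
Proof. by rewrite /avg big_split mulrDl. Qed.

Lemma avgZ c f : avg (fun x => c * f x) = c * avg f.
Proof. by rewrite /avg -big_distrr mulrA. Qed.

Lemma avgB f g : avg (fun x => f x - g x) = avg f - avg g.
Proof. by rewrite /avg sumrB mulrBl. Qed.

Lemma le_avg f g : (forall x, f x <= g x) -> avg f <= avg g.
Proof. by move=> fg; rewrite ler_wpM2r ?invr_ge0 ?ler0n// ler_sum. Qed.

Lemma avg_const c : T -> avg (fun _ : T => c) = c.
Proof.
move=> x0; rewrite /avg sumr_const -[c *+ _]mulr_natr mulfK // pnatr_eq0 -lt0n.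
by apply/card_gt0P; exists x0.
Qed.

Lemma avg_exists (c : R) f : T -> c <= avg f -> exists x, c <= f x.
Proof.
move=> x0 cf; apply/existsP; apply: contraT; rewrite negb_exists => /forallP fc.
have T0 : (0 : R) < #|T|%:R by rewrite ltr0n; apply/card_gt0P; exists x0.
move: cf; rewrite -(avg_const c x0) leNgt /avg ltr_pM2r ?invr_gt0// => /negP; case.
apply: ltr_sum; last by move=> x _; rewrite ltNge.
by apply/hasP; exists x0; rewrite ?mem_index_enum.
Qed.

Lemma dens_ge0 (A : T -> bool) : 0 <= dens A.
Proof. by rewrite divr_ge0 ?sumr_ge0. Qed.

Lemma le_dens (A B : T -> bool) : (forall x, A x -> B x) -> dens A <= dens B.
Proof. by move=> AB; apply: le_avg => x; rewrite ler_nat; case: (A x) (AB x) => // ->. Qed.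

Lemma dens_le1 (A : T -> bool) : T -> dens A <= 1.
Proof.
by move=> x0; rewrite -(avg_const 1 x0); apply: le_avg => x; rewrite lern1 leq_b1.
Qed.

Lemma dens_exists (c : R) (A : T -> bool) : T -> 0 < c -> c <= dens A -> exists x, A x.
Proof.
move=> x0 c0 /(avg_exists x0) [x cx]; exists x.
by case: (A x) cx => //; rewrite leNgt c0.
Qed.

(** Union bound. It turns a choice made separately at each point of [A], among finitely many
    options, into one option that serves a dense set of points. *)
Lemma dens_pigeonhole (S : finType) (c : R) (A : T -> bool) (B : S -> T -> bool) :
  T -> 0 < c -> c <= dens A -> (forall x, A x -> exists s, B s x) ->
  exists s, c / #|S|%:R <= dens (B s).
Proof.
move=> x0 c0 cA AB.
have [s0 _] : exists s0 : S, True.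
  by have [x /AB[s _]] := dens_exists x0 c0 cA; exists s.
apply/existsP; apply: contraT; rewrite negb_exists => /forallP Bc.
have S0 : (0 : R) < #|S|%:R by rewrite ltr0n; apply/card_gt0P; exists s0.
suff : dens A < c by rewrite ltNge cA.
apply: (@le_lt_trans _ _ (\sum_s dens (B s))).
  rewrite /dens /avg -mulr_suml exchange_big ler_wpM2r ?invr_ge0 ?ler0n//.
  apply: ler_sum => x _; case Ax: (A x); last by rewrite sumr_ge0.
  have [s Bs] := AB _ Ax.
  by rewrite (bigD1 s)//= Bs lerDl sumr_ge0.
apply: (@lt_le_trans _ _ (\sum_(s : S) c / #|S|%:R)).
  apply: ltr_sum; last by move=> s _; rewrite ltNge.
  by apply/hasP; exists s0; rewrite ?mem_index_enum.
by rewrite sumr_const -[_ *+ _]mulr_natr divfK// lt0r_neq0.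
Qed.

(** Pointwise, [f] is at most [c] plus the indicator of [c <= f]. *)
Lemma dens_markov (c : R) f : T -> 0 < c -> (forall x, f x <= 1) -> c *+ 2 <= avg f ->
  c <= dens (fun x => c <= f x).
Proof.
move=> x0 c0 f1 cf.
have : avg f <= avg (fun x => (c <= f x)%R%:R + c).
  apply: le_avg => x; have := f1 x; case: (leP c (f x)) => /=; lra.
rewrite avgD (avg_const _ x0) -/(dens _); lra.
Qed.

End Average.

Lemma avg_exchange (R : realFieldType) (S T : finType) (f : S -> T -> R) :
  avg (fun x => avg (f x)) = avg (fun y => avg (f^~ y)).
Proof.
by rewrite /avg -!mulr_suml exchange_big /= mulrAC.
Qed.

(** * Words, subspaces and partitions of the alphabet *)

Section Words.
Variable L : finType.

Definition word (I : finType) : predArgType := {ffun I -> L}.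

Definition mix (I J : finType) (x : word I) (y : word J) : word (I + J)%type :=
  [ffun k => match k with inl i => x i | inr j => y j end].

Lemma avg_mix (R : realFieldType) (I J : finType) (f : word (I + J)%type -> R) :
  avg f = avg (fun x => avg (fun y => f (mix x y))).
Proof.
rewrite /avg.
have -> : \sum_x f x = \sum_(x : word I) \sum_(y : word J) f (mix x y).
  rewrite pair_bigA /=.
  apply: (reindex (fun p : word I * word J => mix p.1 p.2)); apply: onW_bij.
  exists (fun z : word (I + J)%type => ([ffun i => z (inl i)], [ffun j => z (inr j)])).
    by case=> x y; congr pair; apply/ffunP => i; rewrite !ffunE.
  by move=> z; apply/ffunP => -[i|j]; rewrite !ffunE.
rewrite -mulr_suml -mulrA; congr (_ * _).
by rewrite -invfM -natrM !card_ffun card_sum expnD mulnC.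
Qed.

(* In a subspace [s], [inl a] is a constant letter, [inr j] the j-th variable. *)
Definition app (I J : finType) (s : {ffun I -> L + J}) (z : word J) : word I :=
  [ffun i => match s i with inl a => a | inr j => z j end].

Definition allvars (I J : finType) (s : {ffun I -> L + J}) : bool :=
  [forall j, exists i, s i == inr j].

Definition subspace (I J : finType) (F : word J -> word I) : Prop :=
  exists2 s, allvars s & F =1 app s.

Lemma app_inj (I J : finType) (s : {ffun I -> L + J}) :
  allvars s -> injective (app s).
Proof.
move=> /forallP sP x y xy; apply/ffunP => j.
have /existsP[i /eqP si] := sP j.
by move/ffunP/(_ i): xy; rewrite !ffunE si.
Qed.

Lemma subspace_id (I : finType) : subspace (@id (word I)).
Proof.
exists [ffun i => inr i]; first by apply/forallP => i; apply/existsP; exists i; rewrite ffunE.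
by move=> x; apply/ffunP => i; rewrite !ffunE.
Qed.

Lemma subspace_comp (I J K : finType) (F : word J -> word I) (G : word K -> word J) :
  subspace F -> subspace G -> subspace (F \o G).
Proof.
move=> [s sP sF] [t tP tG].
exists [ffun i => match s i with inl a => inl a | inr j => t j end].
  apply/forallP => k; have /existsP[j /eqP tj] := forallP tP k.
  have /existsP[i /eqP si] := forallP sP j.
  by apply/existsP; exists i; rewrite ffunE si tj.
by move=> x; apply/ffunP => i /=; rewrite sF tG !ffunE; case: (s i) => // j; rewrite !ffunE.
Qed.

Lemma subspace_mixl (I I' J : finType) (F : word J -> word I) (y : word I') :
  subspace F -> subspace (fun z => mix (F z) y).
Proof.
move=> [s sP sF].
exists [ffun k => match k with inl i => s i | inr i' => inl (y i') end].
  apply/forallP => j; have /existsP[i /eqP si] := forallP sP j.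
  by apply/existsP; exists (inl i); rewrite ffunE si.
by move=> z; apply/ffunP => -[i|i]; rewrite !ffunE // sF ffunE.
Qed.

Lemma subspace_mixr (I I' J : finType) (x : word I') (F : word J -> word I) :
  subspace F -> subspace (fun z => mix x (F z)).
Proof.
move=> [s sP sF].
exists [ffun k => match k with inl i' => inl (x i') | inr i => s i end].
  apply/forallP => j; have /existsP[i /eqP si] := forallP sP j.
  by apply/existsP; exists (inr i); rewrite ffunE si.
by move=> z; apply/ffunP => -[i|i]; rewrite !ffunE // sF ffunE.
Qed.

Lemma subspace_mix (I I' J J' : finType) (F : word J -> word I) (F' : word J' -> word I') :
  subspace F -> subspace F' ->
  subspace (fun z : word (J + J')%type =>
    mix (F [ffun j => z (inl j)]) (F' [ffun j => z (inr j)])).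
Proof.
move=> [s sP sF] [s' sP' sF'].
exists [ffun k => match k with
  | inl i => match s i with inl a => inl a | inr j => inr (inl j) end
  | inr i => match s' i with inl a => inl a | inr j => inr (inr j) end end].
  apply/forallP => -[j|j].
    have /existsP[i /eqP si] := forallP sP j.
    by apply/existsP; exists (inl i); rewrite ffunE si.
  have /existsP[i /eqP si] := forallP sP' j.
  by apply/existsP; exists (inr i); rewrite ffunE si.
move=> z; apply/ffunP => -[i|i]; rewrite !ffunE.
  by rewrite sF ffunE; case: (s i) => // j; rewrite ffunE.
by rewrite sF' ffunE; case: (s' i) => // j; rewrite ffunE.
Qed.

Lemma subspace_reindex (J J' : finType) (h : J' -> J) :
  (forall j, exists j', h j' = j) ->
  subspace (fun z : word J => [ffun j' => z (h j')] : word J').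
Proof.
move=> hs; exists [ffun j' => inr (h j')].
  by apply/forallP => j; have [j' <-] := hs j; apply/existsP; exists j'; rewrite ffunE.
by move=> z; apply/ffunP => j'; rewrite !ffunE.
Qed.

(* [q] sorts the letters into classes: a [q]-measurable set of words over [L] is
   a set of words over the classes, measured with the image of the uniform law. *)
Definition qmeas (C : Type) (I : finType) (q : L -> L) (A : word I -> C) : Prop :=
  forall x y : word I, (forall i, q (x i) = q (y i)) -> A x = A y.

Lemma subspace_q (I J : finType) (q : L -> L) (F : word J -> word I) (x y : word J) :
  subspace F -> (forall j, q (x j) = q (y j)) -> forall i, q (F x i) = q (F y i).
Proof. by move=> [s _ sF] xy i; rewrite !sF !ffunE; case: (s i). Qed.

Lemma qmeas_comp (C : Type) (I J : finType) (q : L -> L) (A : word I -> C)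
    (F : word J -> word I) : qmeas q A -> subspace F -> qmeas q (A \o F).
Proof. by move=> qA sF x y xy; apply: qA; exact: subspace_q sF xy. Qed.

End Words.

(** * Density Hales-Jewett in higher dimension, and tilings *)

(** Bernoulli's inequality in the form $(1-c)^t (1+tc) \le 1$ makes every $t > 1/(cb)$ suitable. *)
Lemma expr_small (R : archiRealFieldType) (c b : R) :
  0 < c -> c < 1 -> 0 < b -> exists t, (1 - c) ^+ t <= b.
Proof.
move=> c0 c1 b0; exists (Num.bound (c^-1 * b^-1)); set t := Num.bound _.
have bernoulli n : (1 - c) ^+ n * (1 + n%:R * c) <= 1.
  elim: n => [|n IHn]; first by rewrite expr0 mul0r; lra.
  apply: le_trans IHn; rewrite exprSr -mulrA; apply: ler_wpM2l.
    by rewrite exprn_ge0//; lra.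
  rewrite -natr1; have := mulr_ge0 (mulr_ge0 (ler0n R n) (ltW c0)) (ltW c0).
  have := mulr_ge0 (ltW c0) (ltW c0); nra.
have : c^-1 * b^-1 < t%:R.
  by apply: archi_boundP; rewrite mulr_ge0 ?invr_ge0 ?ltW.
rewrite -invfM -[_^-1]mul1r ltr_pdivrMr ?mulr_gt0// => tcb.
have := bernoulli t; have : 0 <= (1 - c) ^+ t by rewrite exprn_ge0//; lra.
set u := (1 - c) ^+ t => u0 ut.
rewrite leNgt; apply/negP => bu.
have ub : 0 <= u - b by lra.
have := mulr_ge0 ub (mulr_ge0 (ler0n R t) (ltW c0)); nra.
Qed.

Section DensityHalesJewett.
Variables (R : archiRealFieldType) (L : finType) (l0 : L).
Implicit Types q : L -> L.
Local Notation word := (word L).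
Local Notation subspace := (@subspace L _ _).

Let w0 (I : finType) : word I := [ffun=> l0].

(* The density Hales-Jewett property for the alphabet of the classes of [q]; the
   lines still run through all letters of [L]. *)
Definition dhj q : Prop := forall d : R, 0 < d -> exists I : finType,
  forall A : word I -> bool, qmeas q A -> d <= dens R A ->
  exists2 F : word unit -> word I, subspace F & forall z, A (F z).

Definition mdhj q : Prop := forall (J : finType) (d : R), 0 < d -> exists I : finType,
  forall A : word I -> bool, qmeas q A -> d <= dens R A ->
  exists2 F : word J -> word I, subspace F & forall z, A (F z).

(** Induction on the dimension. Densely many [y] in the second block have a section of density at
    least [d / 2], which contains an [n]-dimensional subspace. By pigeonhole one and the same [s]
    serves densely many [y], and a line among these adds a dimension. *)
Lemma dhj_mdhj q : dhj q -> mdhj q.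
Proof.
move=> Hq.
suff Hn n (d : R) : 0 < d -> exists I : finType,
    forall A : word I -> bool, qmeas q A -> d <= dens R A ->
    exists2 F : word 'I_n -> word I, subspace F & forall z, A (F z).
  move=> J d d0; have [I HI] := Hn #|J| d d0; exists I => A qA dA.
  have [F sF AF] := HI A qA dA.
  have hs (j : J) : exists j', @enum_val J J j' = j.
    by exists (enum_rank j); rewrite enum_rankK.
  exists (F \o (fun z : word J => [ffun j' => z (enum_val j')])) => [|z]; last exact: AF.
  exact: subspace_comp sF (subspace_reindex L hs).
elim: n d => [|n IHn] d d0.
  exists void => A _ dA; have [x Ax] := dens_exists (w0 _) d0 dA.
  exists (fun=> x) => //.
  exists [ffun i : void => match i with end]; first by apply/forallP; case.
  by move=> z; apply/ffunP; case.
have d2 : 0 < d / 2%:R by lra.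
have [I HI] := IHn _ d2.
pose S := {ffun I -> L + 'I_n}.
have [s0 _] : exists s : S, True by exists [ffun=> inl l0].
have S0 : (0 : R) < #|S|%:R by rewrite ltr0n; apply/card_gt0P; exists s0.
have [I' HI'] := Hq (d / 2%:R / #|S|%:R) (divr_gt0 d2 S0).
exists (I + I')%type => A qA dA.
pose Y (y : word I') := d / 2%:R <= dens R (fun x : word I => A (mix x y)).
have dY : d / 2%:R <= dens R Y.
  apply: dens_markov => //; first exact: w0.
    by move=> y; apply: dens_le1; exact: w0.
  apply: (le_trans _ (le_trans dA _)); first by rewrite -mulr_natr; lra.
  by rewrite /dens avg_mix avg_exchange.
pose B (s : S) (y : word I') := allvars s && [forall z, A (mix (app s z) y)].
have YB y : Y y -> exists s, B s y.
  move=> Yy; have [|F [s sP sF] AF] := HI _ _ Yy.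
    move=> x x' xx'; apply: qA => -[i|i]; rewrite !ffunE //.
  exists s; rewrite /B sP; apply/forallP => z.
  by rewrite -sF; exact: AF.
have [s dB] := dens_pigeonhole (w0 _) d2 dY YB.
have [|G sG BG] := HI' _ _ dB.
  move=> y y' yy'; rewrite /B; congr andb; apply: eq_forallb => z.
  by apply: qA => -[i|i]; rewrite !ffunE.
have sP : allvars s by have /andP[] := BG (w0 _).
have sub_s : subspace (app s) by exists s.
pose h (j : 'I_n + unit) : 'I_n.+1 := match j with inl i => lift ord0 i | inr _ => ord0 end.
have hs j : exists j', h j' = j.
  case: (unliftP ord0 j) => [i ->|->]; first by exists (inl i).
  by exists (inr tt).
have sF := subspace_comp (subspace_mix sub_s sG) (subspace_reindex L hs).
eexists; first exact: sF.
by move=> z /=; have /andP[_ /forallP] := BG [ffun j => [ffun j' => z (h j')] (inr j)].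
Qed.

(** As [app s] is injective, the factor is the density of the subspace among all words. *)
Lemma avg_subspace (I J : finType) (s : {ffun I -> L + J}) (f : word I -> R) :
  allvars s ->
  avg (fun x => f x * (x \in codom (app s))%:R) =
  #|word J|%:R / #|word I|%:R * avg (f \o app s).
Proof.
move=> sP; have inj := app_inj sP.
have J0 : (0 : R) < #|word J|%:R.
  by rewrite ltr0n; apply/card_gt0P; exists (w0 _).
rewrite /avg [RHS]mulrC mulrA divfK ?lt0r_neq0//; congr (_ / _).
rewrite (eq_bigr (fun x => if x \in codom (app s) then f x else 0)); last first.
  by move=> x _; case: ifP; rewrite ?mulr1 ?mulr0.
rewrite -big_mkcond /= -big_uniq ?big_map ?big_enum //=; last first.
  by rewrite map_inj_uniq // enum_uniq.
Qed.

(* With [f = 1_A - c], this says that a set [A] whose density on subspaces is at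
   most [c] has at most that relative density in [D]. Over the first block, each
   section of [D] of density >= eps/2 contains a subspace, which we peel off. The
   subspace is chosen from the section alone, so what remains of [D] is still
   [q]-measurable in the other blocks, and its excess density over eps/2 has
   dropped by the factor [1 - c']. *)
Lemma tile q (eps : R) (J : finType) : mdhj q -> 0 < eps -> exists I : finType,
  forall (f : word I -> R) (D : word I -> bool),
    (forall x, f x <= 1) -> qmeas q D ->
    (forall F : word J -> word I, subspace F -> avg (f \o F) <= 0) ->
  avg (fun x => f x * (D x)%:R) <= eps.
Proof.
move=> Hq e0; pose b := eps / 2%:R; have b0 : 0 < b by rewrite /b; lra.
have [M HM] := Hq J b b0.
pose c : R := #|word J|%:R / #|word M|%:R.
have card0 (K : finType) : (0 : R) < #|word K|%:R.
  by rewrite ltr0n; apply/card_gt0P; exists (w0 _).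
have c0 : 0 < c by rewrite divr_gt0.
(* [c] need not be below 1, whereas [expr_small] wants a rate strictly below 1. *)
pose c' := Num.min c (1 / 2%:R).
have c'0 : 0 < c' by rewrite /c' lt_min c0; lra.
have c'c : c' <= c by rewrite /c' ge_min lexx.
have c'1 : c' < 1 by rewrite /c' gt_min; apply/orP; right; lra.
suff Ht t : exists I : finType, forall (f : word I -> R) (D : word I -> bool),
    (forall x, f x <= 1) -> qmeas q D ->
    (forall F : word J -> word I, subspace F -> avg (f \o F) <= 0) ->
    avg (fun x => f x * (D x)%:R) <= b + (1 - c') ^+ t * (dens R D - b).
  have [t tP] := expr_small c'0 c'1 b0.
  have [I HI] := Ht t; exists I => f D f1 qD fF.
  apply: (le_trans (HI f D f1 qD fF)).
  have : (1 - c') ^+ t * (dens R D - b) <= (1 - c') ^+ t * 1.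
    apply: ler_wpM2l; first by rewrite exprn_ge0//; lra.
    have := @dens_le1 R _ D (w0 _); lra.
  have := tP; rewrite /b; lra.
elim: t => [|t [I HI]].
  exists void => f D f1 qD fF; rewrite expr0 mul1r addrC subrK.
  apply: le_avg => x; case: (D x); rewrite ?mulr1 ?mulr0//.
exists (M + I)%type => f D f1 qD fF.
pose V (y : word I) (s : {ffun M -> L + J}) :=
  allvars s && [forall z, D (mix (app s z) y)].
pose N x y := if [pick s | V y s] is Some s then x \in codom (app s) else false.
pose D' x y := D (mix x y) && ~~ N x y.
have ND x y : N x y -> D (mix x y).
  rewrite /N; case: pickP => // s /andP[_ /forallP Vs] /codomP[z ->]; exact: Vs.
have DE x y : (D (mix x y))%:R = (D' x y)%:R + (N x y)%:R :> R.
  rewrite /D'; have := @ND x y; case: (N x y) => [->|_]//=; first by rewrite add0r.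
  by rewrite andbT addr0.
have qV (y y' : word I) : (forall i, q (y i) = q (y' i)) -> V y =1 V y'.
  move=> yy' s; rewrite /V; congr andb; apply: eq_forallb => z.
  by apply: qD => -[i|i]; rewrite !ffunE.
have qD' x : qmeas q (D' x).
  move=> y y' yy'; rewrite /D' /N (eq_pick (qV _ _ yy')); congr andb.
  by apply: qD => -[i|i]; rewrite !ffunE.
have fN y : avg (fun x => f (mix x y) * (N x y)%:R) <= 0.
  rewrite /N; case: pickP => [s /andP[sP _]|_].
    rewrite (avg_subspace (fun x => f (mix x y)))//.
    rewrite mulr_ge0_le0 ?divr_ge0 ?ler0n//.
    by apply: (fF (fun z => mix (app s z) y)); apply: subspace_mixl; exists s.
  by rewrite (eq_avg (g := fun=> 0)) ?avg_const // => [|x]; [exact: w0|rewrite mulr0].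
(* A picked subspace has density [c], and the excess over [b] is at most 1. If none is picked, the
   choice of [M] forces the section to have density at most [b]. *)
have dN y : c' * (dens R (fun x => D (mix x y)) - b) <= dens R (N^~ y).
  rewrite /N; case: pickP => [s /andP[sP _]|noV].
    have -> : dens R (fun x => x \in codom (app s)) = c.
      rewrite /dens (eq_avg (g := fun x => 1 * (x \in codom (app s))%:R)).
        by rewrite (avg_subspace (fun=> 1))// avg_const ?mulr1//; exact: w0.
      by move=> x; rewrite mul1r.
    apply: (le_trans _ c'c); rewrite -[leRHS]mulr1 ler_pM2l//.
    have := @dens_le1 R _ (fun x => D (mix x y)) (w0 _); lra.
  rewrite {2}/dens (eq_avg (g := fun=> 0)) // avg_const; last exact: w0.
  rewrite pmulr_rle0// subr_le0 leNgt; apply/negP => /ltW db.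
  have [|F [s sP sF] AF] := HM _ _ db.
    by move=> x x' xx'; apply: qD => -[i|i]; rewrite !ffunE.
  have /negP := noV s; apply; rewrite /V sP; apply/forallP => z.
  by rewrite -sF; exact: AF.
rewrite avg_mix.
(* The peeled part is averaged over [x] first, where the hypothesis on subspaces applies; the
   remainder over [y] first, where the induction hypothesis applies to [D' x]. *)
have -> : avg (fun x => avg (fun y => f (mix x y) * (D (mix x y))%:R)) =
    avg (fun x => avg (fun y => f (mix x y) * (D' x y)%:R)) +
    avg (fun y => avg (fun x => f (mix x y) * (N x y)%:R)).
  rewrite [X in _ + X]avg_exchange -avgD; apply: eq_avg => x.
  by rewrite -avgD; apply: eq_avg => y; rewrite DE mulrDr.
have h1 : avg (fun y => avg (fun x => f (mix x y) * (N x y)%:R)) <= 0.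
  by rewrite -(avg_const 0 (w0 I)); apply: le_avg.
have h2 : avg (fun x => avg (fun y => f (mix x y) * (D' x y)%:R)) <=
    avg (fun x => b + (1 - c') ^+ t * (dens R (D' x) - b)).
  apply: le_avg => x; apply: HI => // F sF.
  by apply: (fF (fun z => mix x (F z))); exact: subspace_mixr.
have h3 : avg (fun x => dens R (D' x)) <= dens R D - c' * (dens R D - b).
  pose g (y : word I) := dens R (fun x => D (mix x y)).
  have -> : dens R D = avg g.
    by rewrite /dens avg_mix avg_exchange.
  have : avg (fun x => dens R (D' x)) <=
      avg (fun y => g y - c' * (g y - b)).
    rewrite /dens avg_exchange -/(dens _ _); apply: le_avg => y.
    have : dens R (fun x => D (mix x y)) =
        avg (fun x => (D' x y)%:R) + dens R (N^~ y).
      by rewrite /dens -avgD; apply: eq_avg => x; rewrite DE.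
    have := dN y; rewrite /g /dens; lra.
  rewrite (avgB g) (avgZ c') (avgB g) avg_const //; exact: w0.
move: h2; rewrite (avgD (fun=> b)) (avgZ (_ ^+ t)) (avgB (fun x => dens R (D' x))).
rewrite !(avg_const b (w0 M)).
have : (1 - c') ^+ t * (avg (fun x => dens R (D' x)) - b) <=
    (1 - c') ^+ t * ((1 - c') * (dens R D - b)).
  apply: ler_wpM2l; first by rewrite exprn_ge0//; lra.
  lra.
rewrite exprSr -mulrA; lra.
Qed.

End DensityHalesJewett.

(** * The coloring Hales-Jewett theorem *)

Section Identify.
Variable L : finType.
Implicit Types q : L -> L.

(** When [q b] and [q c] differ, the class of [b] is merged into that of [c]. One class disappears,
    which drives the inductions on [#|codom q|]. *)
Definition identify q (b c l : L) : L := if q l == q b then q c else q l.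

Lemma card_identify q b c : q b != q c ->
  (#|codom (identify q b c)| < #|codom q|)%N.
Proof.
move=> bc; apply: proper_card; apply/properP; split.
  apply/fintype.subsetP => _ /codomP[l ->]; rewrite /identify.
  by case: ifP => _; exact: codom_f.
exists (q b); first exact: codom_f.
apply/codomP => -[l]; rewrite /identify; case: ifPn => [_ /eqP|lb /eqP].
  by rewrite (negbTE bc).
by rewrite eq_sym (negbTE lb).
Qed.

Lemma qmeas_identify (C : Type) q b c (phi : L -> C) :
  (forall l l', q l = q l' -> phi l = phi l') -> phi b = phi c ->
  forall l l', identify q b c l = identify q b c l' -> phi l = phi l'.
Proof.
move=> qphi bc l l'; rewrite /identify.
case: eqP => [/qphi lb|_]; case: eqP => [/qphi lb'|_] //.
- by rewrite lb lb'.
- by move=> /qphi <-; rewrite lb.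
- by move=> /qphi ->; rewrite lb' -bc.
- exact: qphi.
Qed.

End Identify.

Section HalesJewett.
Variable L : finType.
Implicit Types q : L -> L.
Local Notation word := (word L).

(* The letters [b] and [c] become interchangeable on a subspace: in each block,
   two of the words b^j c^(N-j) have the same colour in every context. *)
Lemma shelah q (b c : L) (J C : finType) : exists I : finType,
  forall chi : word I -> C, qmeas q chi ->
  exists2 F : word J -> word I, subspace F & qmeas (identify q b c) (chi \o F).
Proof.
suff Hn n (C' : finType) : exists I : finType,
    forall chi : word I -> C', qmeas q chi ->
    exists2 F : word 'I_n -> word I, subspace F & qmeas (identify q b c) (chi \o F).
  have [I HI] := Hn #|J| C; exists I => chi qchi.
  have [F sF FF] := HI chi qchi.
  have hs (j : J) : exists j', @enum_val J J j' = j.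
    by exists (enum_rank j); rewrite enum_rankK.
  have sH := subspace_reindex L hs.
  by eexists; [exact: subspace_comp sF sH | exact: qmeas_comp FF sH].
elim: n C' {C} => [|n IHn] C.
  exists void => chi _; exists (fun=> [ffun i : void => match i with end]) => //.
  exists [ffun i : void => match i with end]; first by apply/forallP; case.
  by move=> z; apply/ffunP; case.
(* The last [n] variables are handled for the colouring that records the colours for all letters of
   the first variable at once, so that they can be changed whatever that letter is. *)
have [I HI] := IHn {ffun L -> C}.
(* By pigeonhole, two of the [N + 1] words [u j] induce the same colouring of the contexts. *)
pose N := #|{: {ffun word I -> C}}|.
exists ('I_N + I)%type => chi qchi.
pose u (j : nat) : word 'I_N := [ffun i : 'I_N => if (i < j)%N then b else c].
pose k (j : 'I_N.+1) : {ffun word I -> C} := [ffun y => chi (mix (u j) y)].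
have [j [j' [jj' kjj']]] : exists j j' : 'I_N.+1, (j < j')%N /\ k j = k j'.
  have /injectivePn[j [j' jj' kjj']] : ~~ injectiveb k.
    apply/negP => /injectiveP/leq_card; rewrite card_ord.
    by rewrite -/N ltnn.
  have := jj'; rewrite -(inj_eq val_inj) neq_ltn => /orP[lt|lt].
    by exists j, j'.
  by exists j', j.
(* Putting [b] in the variable gives [u j'], putting [c] gives [u j]. *)
pose s : {ffun 'I_N -> L + unit} := [ffun i : 'I_N =>
  if (i < j)%N then inl b else if (i < j')%N then inr tt else inl c].
have sP : allvars s.
  have jN : (j < N)%N by apply: leq_trans jj' _; rewrite -ltnS.
  apply/forallP => -[]; apply/existsP; exists (Ordinal jN).
  by rewrite ffunE /= ltnn jj'.
pose chi' (y : word I) : {ffun L -> C} := [ffun l => chi (mix (app s [ffun=> l]) y)].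
have [|F sF FF] := HI chi'.
  move=> y y' yy'; apply/ffunP => l; rewrite !ffunE.
  by apply: qchi => -[i|i]; rewrite !ffunE.
have sub_s : subspace (app s) by exists s.
pose h (j : unit + 'I_n) : 'I_n.+1 :=
  match j with inr i => lift ord0 i | inl _ => ord0 end.
have hs i : exists j', h j' = i.
  case: (unliftP ord0 i) => [i' ->|->]; first by exists (inr i').
  by exists (inl tt).
have sG := subspace_comp (subspace_mix sub_s sF) (subspace_reindex L hs).
eexists; first exact: sG.
have unitE (z : word unit) : z = [ffun=> z tt] by apply/ffunP => -[]; rewrite ffunE.
have step (z1 : word unit) (z2 z2' : word 'I_n) :
    (forall i, identify q b c (z2 i) = identify q b c (z2' i)) ->
    chi (mix (app s z1) (F z2)) = chi (mix (app s z1) (F z2')).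
  by move=> /(FF z2 z2')/ffunP/(_ (z1 tt)); rewrite !ffunE -unitE.
move=> x y xy /=.
set x1 := [ffun j => _ (inl j)]; set x2 := [ffun j => _ (inr j)].
set y1 := [ffun j => _ (inl j)]; set y2 := [ffun j => _ (inr j)].
transitivity (chi (mix (app s x1) (F y2))).
  by apply: step => i; rewrite !ffunE.
have bc : chi (mix (app s [ffun=> b]) (F y2)) = chi (mix (app s [ffun=> c]) (F y2)).
  have -> : app s [ffun=> b] = u j'.
    apply/ffunP => i; rewrite !ffunE; case: ltnP => [ij|_].
      by rewrite (ltn_trans ij jj').
    by case: ifP; rewrite ?ffunE.
  have -> : app s [ffun=> c] = u j.
    apply/ffunP => i; rewrite !ffunE; case: ltnP => // _.
    by case: ifP; rewrite ?ffunE.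
  by have /ffunP/(_ (F y2)) := kjj'; rewrite !ffunE.
rewrite (unitE x1) (unitE y1).
pose phi l := chi (mix (app s [ffun=> l]) (F y2)).
apply: (@qmeas_identify _ _ q b c phi) => //.
  move=> l l' ll'; apply: qchi => -[i|i]; rewrite !ffunE //.
  by case: ifP => //; case: ifP; rewrite ?ffunE.
by rewrite !ffunE.
Qed.

(** Each use of [shelah] merges two classes, at the price of a larger dimension. With a single
    class, a [q]-measurable colouring is constant. *)
Lemma hales_jewett_q q (C : finType) : exists I : finType,
  forall chi : word I -> C, qmeas q chi ->
  exists2 F : word unit -> word I, subspace F & forall z z', chi (F z) = chi (F z').
Proof.
have [m qm] := ubnP #|codom q|; elim: m q qm C => // m IHm q qm C.
case: (pickP (fun p : L * L => q p.1 != q p.2)) => [[b c] /= bc|qq].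
  have [I HI] := IHm (identify q b c) (leq_trans (card_identify bc) qm) C.
  have [I' HI'] := shelah q b c I C.
  exists I' => chi /HI'[F sF /HI[G sG FG]].
  by exists (F \o G) => //; exact: subspace_comp.
exists unit => chi qchi; exists id; first exact: subspace_id.
by move=> z z'; apply: qchi => i; have /negbFE/eqP := qq (z i, z' i).
Qed.

Lemma hales_jewett (C : finType) : exists I : finType, forall chi : word I -> C,
  exists2 F : word unit -> word I, subspace F & forall z z', chi (F z) = chi (F z').
Proof.
have [I HI] := hales_jewett_q id C; exists I => chi; apply: HI => x y xy.
by congr chi; apply/ffunP.
Qed.

End HalesJewett.

(** * Variable words inside subspaces *)

Section VariableWords.
Variable L : finType.

(* In a variable word, [None] is the variable. *)
Definition fill (I : finType) (p : {ffun I -> option L}) (a : L) : word L I :=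
  [ffun i => odflt a (p i)].

Definition plug (I J : finType) (s : {ffun I -> L + J}) (p : {ffun J -> option L}) :
    {ffun I -> option L} :=
  [ffun i => match s i with inl a => Some a | inr j => p j end].

Lemma fill_plug (I J : finType) (s : {ffun I -> L + J}) p a :
  fill (plug s p) a = app s (fill p a).
Proof. by apply/ffunP => i; rewrite !ffunE; case: (s i) => // j; rewrite ffunE. Qed.

Definition fcons (T : Type) (J : finType) (x : T) (u : J -> T) : {ffun option J -> T} :=
  [ffun o => if o is Some j then u j else x].

(* [I0]-tuples of variable words of length [K * J] define [I0]-subspaces: colour
   each tuple by the pattern [p] of a good variable word in its subspace. Along a
   monochromatic line of tuples, one can vary freely the words of one block [i0]
   with [p i0 = None], the variable being visible there without modification. *)
Lemma good_variable_words (l0 : L) (I0 J : finType) : exists M : finType,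
  forall P : {ffun M -> option L} -> bool,
  (forall s : {ffun M -> L + I0}, allvars s ->
    exists2 p : {ffun I0 -> option L}, (exists i, p i = None) & P (plug s p)) ->
  exists2 s : {ffun M -> L + option J}, allvars s &
    forall u : {ffun J -> option L}, P (plug s (fcons None u)).
Proof.
pose V : finType := {ffun I0 -> option L}; pose X : finType := {ffun J -> V}.
have [K HK] := hales_jewett X V.
(* In each row [i], the extra column [None] holds the [i]-th variable, so that [S w] uses all the
   variables whatever the letters of [w] are. *)
exists (I0 * option (K * J))%type => P HP.
pose S (w : word X K) : {ffun I0 * option (K * J) -> L + I0} :=
  [ffun m => match m.2 with
   | None => inr m.1
   | Some kj => match w kj.1 kj.2 m.1 with None => inr m.1 | Some l => inl l end
   end].
have SP w : allvars (S w).
  by apply/forallP => i; apply/existsP; exists (i, None); rewrite ffunE.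
pose good w (p : V) := [exists i, p i == None] && P (plug (S w) p).
have goodP w : exists p, good w p.
  have [p [i pi] Pp] := HP _ (SP w); exists p.
  by rewrite /good Pp andbT; apply/existsP; exists i; rewrite pi.
pose chi w := xchoose (goodP w).
have [F [t tP tF] FF] := HK chi.
have [i0 /eqP pi0] : exists i0, chi (F [ffun=> [ffun=> [ffun=> None]]]) i0 == None.
  by have /andP[/existsP] := xchooseP (goodP (F [ffun=> [ffun=> [ffun=> None]]])).
set p := chi _ in pi0.
pose pv i : L + option J := match p i with None => inr None | Some l => inl l end.
pose s : {ffun I0 * option (K * J) -> L + option J} := [ffun m =>
  match m.2 with
  | None => pv m.1
  | Some kj => match t kj.1 with
    | inl x => match x kj.2 m.1 with None => pv m.1 | Some l => inl l end
    | inr _ => if m.1 == i0 then inr (Some kj.2) else inl l0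
    end
  end].
exists s.
  apply/forallP => -[j|]; apply/existsP.
    have /existsP[k /eqP tk] := forallP tP tt.
    by exists (i0, Some (k, j)); rewrite ffunE /= tk eqxx.
  by exists (i0, None); rewrite ffunE /= /pv pi0.
move=> u.
(* On this point of the line row [i0] carries [u] and the other rows carry [l0]. Plugging [p] into
   its subspace gives [plug s (fcons None u)]: since [p i0 = None], the entries [None] of [u] stay
   variables. *)
pose z : word X unit := [ffun=> [ffun j => [ffun i => if i == i0 then u j else Some l0]]].
have /andP[_] := xchooseP (goodP (F z)).
rewrite -/(chi _) (FF z [ffun=> [ffun=> [ffun=> None]]]) -/p.
congr (is_true (P _)); apply/ffunP => -[i [[k j]|]]; rewrite !ffunE /=; last first.
  by rewrite /pv; case: (p i) => //; rewrite ffunE.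
rewrite tF ffunE; case: (t k) => [x|[]].
  by case: (x j i) => //; rewrite /pv; case: (p i) => //; rewrite ffunE.
rewrite !ffunE; case: eqP => [->|//]; rewrite ffunE.
by case: (u j).
Qed.

End VariableWords.

(** * The density Hales-Jewett theorem *)

Section Increment.
Variables (R : archiRealFieldType) (L : finType) (l0 : L).
Implicit Types q : L -> L.
Local Notation word := (word L).
Local Notation subspace := (@subspace L _ _).
Local Notation mdhj := (mdhj R).

Let w0 (I : finType) : word I := [ffun=> l0].

(** The complement of the intersection is the disjoint union of the complement of [C c] and of the
    part of [C c] outside the other sets. [tile] reduces each piece to averages over subspaces of
    dimension [J1], bounded by induction. The bound on [avg f] is carried along because the first
    piece needs it on those subspaces. *)
Lemma tile_union q (b : L) (s : seq L) (eps : R) (J : finType) :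
  (forall c, c \in s -> mdhj (identify q b c)) -> 0 < eps ->
  exists I : finType, forall (f : word I -> R) (C : L -> word I -> bool),
    (forall x, f x <= 1) -> (forall c, c \in s -> qmeas (identify q b c) (C c)) ->
    (forall F : word J -> word I, subspace F -> avg (f \o F) <= 0) ->
  avg (fun x => f x * (~~ all (C^~ x) s)%:R) <= eps /\ avg f <= eps.
Proof.
elim: s eps => [|c s IHs] eps Hs e0.
  exists J => f C f1 _ fF; split; last first.
    by apply: le_trans (ltW e0); exact: (fF _ (subspace_id _ _)).
  rewrite (eq_avg (g := fun=> 0)) ?avg_const ?ltW //; first exact: w0.
  by move=> x; rewrite mulr0.
have e4 : 0 < eps / 4%:R by lra.
have [|J1 HJ1] := IHs _ _ e4.
  by move=> c' c's; apply: Hs; rewrite inE c's orbT.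
have [I HI] := tile l0 J1 (Hs c (mem_head _ _)) e4.
exists I => f C f1 qC fF.
set e := eps / 4%:R in e4 HJ1 HI.
have HF (F : word J1 -> word I) : subspace F ->
    avg (fun x => f (F x) * (~~ all (C^~ (F x)) s)%:R) <= e /\ avg (f \o F) <= e.
  move=> sF; apply: (HJ1 (f \o F) (fun c' => C c' \o F)).
  - by move=> x; exact: f1.
  - move=> c' c's; apply: qmeas_comp => //; apply: qC.
    by rewrite inE c's orbT.
  - by move=> G sG; apply: (fF (F \o G)); exact: subspace_comp.
(* [tile] wants nonpositive averages on subspaces, so it is applied to [g - e]; undoing the shift
   costs a second [e]. *)
have HD (g : word I -> R) (D : word I -> bool) : (forall x, g x <= 1) ->
    qmeas (identify q b c) D ->
    (forall F : word J1 -> word I, subspace F -> avg (g \o F) <= e) ->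
    avg (fun x => g x * (D x)%:R) <= e + e.
  move=> g1 qD gF.
  have : avg (fun x => (g x - e) * (D x)%:R) <= e.
    apply: HI => // [x|F sF]; first by have := g1 x; lra.
    rewrite (eq_avg (g := fun x => (g \o F) x - e)) // avgB avg_const; last exact: w0.
    by have := gF F sF; lra.
  have : avg (fun x => g x * (D x)%:R) <= avg (fun x => (g x - e) * (D x)%:R + e).
    by apply: le_avg => x; case: (D x) => /=; lra.
  rewrite avgD avg_const; [lra | exact: w0].
have qCc : qmeas (identify q b c) (C c) by apply: qC; rewrite mem_head.
pose g x := f x * (~~ all (C^~ x) s)%:R.
have g1 x : g x <= 1.
  by rewrite /g; have := f1 x; case: (all _ _); rewrite ?mulr0 ?mulr1 ?ler01.
have h1 : avg (fun x => g x * (C c x)%:R) <= e + e.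
  by apply: HD => // F sF; have [] := HF F sF.
have h2 : avg (fun x => f x * (~~ C c x)%:R) <= e + e.
  apply: (HD f (fun x => ~~ C c x)) => // [x y xy|F sF].
    by rewrite (qCc x y xy).
  by have [] := HF F sF.
have h3 : avg f <= e + e.
  rewrite (eq_avg (g := fun x => f x * (xpredT x)%:R)); last by move=> x; rewrite mulr1.
  by apply: HD => // F sF; have [] := HF F sF.
have eE : eps = e + e + e + e by rewrite /e; lra.
split; last by lra.
have -> : avg (fun x => f x * (~~ all (C^~ x) (c :: s))%:R) =
    avg (fun x => f x * (~~ C c x)%:R) + avg (fun x => g x * (C c x)%:R).
  rewrite -avgD; apply: eq_avg => x; rewrite /g /=.
  by case: (C c x) => /=; rewrite ?mulr0 ?mulr1 ?add0r ?addr0.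
lra.
Qed.

(** If some section is too thin, another one is denser than [A] by at least [eta]; pass to it and
    repeat. As densities stay at most 1, this stops after a number of rounds bounded in terms of
    [eta]. *)
Lemma uniform_sections (M : finType) (e : R) : 0 < e -> exists I : finType,
  forall (A : word I -> bool) (d : R), d <= dens R A ->
  exists (I' : finType) (F : word (M + I')%type -> word I), subspace F /\
    forall z, d - e <= dens R (fun y => A (F (mix z y))).
Proof.
move=> e0.
have N0 : (0 : R) < #|word M|%:R by rewrite ltr0n; apply/card_gt0P; exists (w0 _).
pose eta := e / #|word M|%:R; have eta0 : 0 < eta by rewrite divr_gt0.
suff Ht t : exists I : finType, forall (A : word I -> bool) (d : R),
    d <= dens R A -> 1 - t%:R * eta < dens R A ->
    exists (I' : finType) (F : word (M + I')%type -> word I), subspace F /\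
      forall z, d - e <= dens R (fun y => A (F (mix z y))).
  have [I HI] := Ht (Num.bound eta^-1); exists I => A d dA; apply: HI => //.
  apply: lt_le_trans (dens_ge0 _ _).
  rewrite subr_lt0 -ltr_pdivrMr// mul1r; apply: archi_boundP.
  by rewrite invr_ge0 ltW.
elim: t => [|t [I HI]].
  exists void => A d _; rewrite mul0r subr0 ltNge => /negP; case.
  by apply: dens_le1; exact: w0.
exists (M + I)%type => A d dA tA.
case: (boolP [forall z, d - e <= dens R (fun y => A (mix z y))]) => [/forallP Az|].
  by exists I, id; split; [exact: subspace_id|].
rewrite negb_forall => /existsP[z0]; rewrite -ltNge => z0P.
have dAE : dens R A = avg (fun z => dens R (fun y => A (mix z y))).
  by rewrite /dens avg_mix.
(* Adding [e] at the thin [z0] lifts the average by [eta] but keeps the value there below [d], so a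
   word reaching the lifted average is not [z0]. *)
have [z1 z1P] : exists z1, dens R A + eta <=
    dens R (fun y => A (mix z1 y)) + e * (z1 == z0)%:R.
  apply: avg_exists; first exact: w0.
  rewrite avgD avgZ -dAE lerD2l /eta ler_pM2l//.
  rewrite /avg (bigD1 z0)//= eqxx big1 ?addr0 ?mul1r//.
  by move=> z /negbTE ->.
have z1A : dens R A + eta <= dens R (fun y => A (mix z1 y)).
  move: z1P; case: eqP => [->|_]; last by rewrite mulr0 addr0.
  by rewrite mulr1; lra.
have [||I' [F [sF FP]]] := HI (fun y => A (mix z1 y)) d; first by lra.
  by move: tA; rewrite -natr1; lra.
exists I', (fun z => mix z1 (F z)); split => //.
exact: subspace_mixr.
Qed.

Lemma subspace_fcons_const (J : finType) (b : L) :
  subspace (fun x : word J => fcons b x).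
Proof.
exists [ffun o => if o is Some j then inr j else inl b].
  by apply/forallP => j; apply/existsP; exists (Some j); rewrite ffunE.
by move=> z; apply/ffunP => -[j|]; rewrite !ffunE.
Qed.

Lemma subspace_fill (J : finType) (p : {ffun J -> option L}) :
  (exists i, p i = None) -> subspace (fun z : word unit => fill p (z tt)).
Proof.
move=> [i pi]; exists [ffun j => if p j is Some a then inl a else inr tt].
  by apply/forallP => -[]; apply/existsP; exists i; rewrite ffunE pi.
by move=> z; apply/ffunP => j; rewrite !ffunE; case: (p j).
Qed.

(* Restrict [A] to a subspace spanned by a block of variables, the first of which
   is set to [b], and let [C c] be the set of words that fall into [A] when all
   letters of the class of [b], the first one included, are replaced by [c].
   A word of [A] lying in every [C c] yields a line of [A]; so if there is no line,
   [A] avoids the intersection of the [C c], whose density is at least [th] thanks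
   to the property for the merged classes and to [good_variable_words], and it is
   denser on the complement. There [tile_union] finds the subspace. It matters
   that [th] does not depend on the dimension of the block. *)
Lemma density_increment q (b c0 : L) (d : R) : q c0 != q b ->
  (forall c, q c != q b -> mdhj (identify q b c)) -> 0 < d ->
  exists2 g : R, 0 < g & forall J : finType, exists I : finType,
  forall (A : word I -> bool) (d' : R), qmeas q A -> d <= d' -> d' <= dens R A ->
  (exists2 F : word unit -> word I, subspace F & forall z, A (F z)) \/
  (exists2 F : word J -> word I, subspace F & d' + g <= dens R (A \o F)).
Proof.
move=> c0b Hid d0.
(* Composed with this substitution, [A] becomes measurable for the partition with the class of [b]
   merged into that of [c0], for which [mdhj] is available. *)
pose r l := if q l == q b then c0 else l.
have qr l : q (r l) = identify q b c0 l by rewrite /r /identify; case: ifP.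
have d4 : 0 < d / 4%:R by lra.
have [I0 HI0] := Hid c0 c0b unit _ d4.
pose V := {: {ffun I0 -> option L}}.
have V0 : (1 : R) <= #|V|%:R.
  by rewrite ler1n; apply/card_gt0P; exists [ffun=> None].
(* Contexts [y] with a dense section over [I0] have density at least [d / 4]; this is shared among
   the patterns that a line of words over [I0] may have. *)
pose th := d / 4%:R / #|V|%:R.
have th0 : 0 < th by rewrite divr_gt0//; lra.
have thd : th <= d / 4%:R.
  by rewrite /th ler_pdivrMr ?ler_peMr//; lra.
pose rho (I : finType) (x : word I) : word I := [ffun i => r (x i)].
(* Chosen so that [4 e = d * th]: avoiding the intersection gains at least [4 e], while the uneven
   sections and the intended increment cost [2 e]. *)
pose e := d * th / 4%:R.
have e0 : 0 < e by rewrite /e; have := mulr_gt0 d0 th0; lra.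
exists e => // J0.
pose s := [seq c <- enum L | q c != q b].
have [|J HJ] := @tile_union q b s e J0 _ e0.
  by move=> c; rewrite mem_filter => /andP[+ _]; exact: Hid.
have [M HM] := good_variable_words l0 I0 J.
have [I HI] := uniform_sections M e0.
exists I => A d' qA dd' dA.
have [I' [F [sF sec]]] := HI A d' dA.
pose A1 := A \o F.
have qA1 : qmeas q A1 by exact: qmeas_comp.
pose B (v : {ffun M -> option L}) (y : word I') := [forall a, A1 (mix (rho _ (fill v a)) y)].
have [|S SP good] := HM (fun v => th <= dens R (B v)).
  move=> S SP.
  pose Z y (z : word I0) := A1 (mix (rho _ (app S z)) y).
  have d'1 : d' <= 1 by apply: (le_trans dA); apply: dens_le1; exact: w0.
  have : d / 4%:R *+ 2 <= avg (fun y => dens R (Z y)).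
    rewrite /dens avg_exchange -(avg_const (d / 4%:R *+ 2) (w0 I0)).
    apply: le_avg => z; apply: le_trans (sec (rho _ (app S z))).
    have : e <= d / 4%:R.
      rewrite /e; have := ler_wpM2l (ltW d0) (_ : th <= 1); rewrite mulr1; lra.
    rewrite -mulr_natr; lra.
  move=> /(dens_markov (w0 _) d4) dZ.
  have dZ' : d / 4%:R <= dens R (fun y => d / 4%:R <= dens R (Z y)).
    by apply: dZ => y; apply: dens_le1; exact: w0.
  have [|p pP] := @dens_pigeonhole _ _ {ffun I0 -> option L} _ _
      (fun p y => [exists i, p i == None] && B (plug S p) y) (w0 _) d4 dZ'.
    move=> y Zy; have [|G [t tP tG] ZG] := HI0 _ _ Zy.
      move=> x x' xx'; apply: qA1 => -[i|i]; rewrite !ffunE //.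
      by case: (S i) => // j; rewrite !qr.
    exists [ffun i => match t i with inl a => Some a | inr _ => None end].
    apply/andP; split.
      have /existsP[i /eqP ti] := forallP tP tt.
      by apply/existsP; exists i; rewrite ffunE ti.
    apply/forallP => a; rewrite fill_plug.
    have := ZG [ffun=> a]; rewrite /Z tG.
    congr (is_true (A1 (mix (rho _ (app S _)) y))).
    by apply/ffunP => i; rewrite !ffunE; case: (t i) => // u; rewrite ffunE.
  have [y /andP[/existsP[i /eqP pi] _]] := dens_exists (w0 _) th0 pP.
  exists p; first by exists i.
  by apply: (le_trans pP); apply: le_dens => y' /andP[].
pose Sr : {ffun M -> L + option J} :=
  [ffun m => match S m with inl a => inl (r a) | inr o => inr o end].
have sSr : subspace (app Sr).
  exists Sr => //; apply/forallP => o; have /existsP[m /eqP Sm] := forallP SP o.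
  by apply/existsP; exists m; rewrite ffunE Sm.
pose repl (x : word J) c : word J := [ffun j => if q (x j) == q b then c else x j].
pose A' (x : word J) (y : word I') := A1 (mix (app Sr (fcons b x)) y).
pose C y c x := A1 (mix (app Sr (fcons c (repl x c))) y).
have qC y c : c \in s -> qmeas (identify q b c) (C y c).
  rewrite mem_filter => /andP[cb _] x x' xx'.
  apply: qA1 => -[m|i]; rewrite !ffunE //.
  case: (S m) => // -[j|]; rewrite ?ffunE // ?ffunE.
  by move: (xx' j); rewrite /identify; case: ifP; case: ifP.
case: (boolP [exists x : word J, exists y : word I', A' x y && all (C y ^~ x) s]).
  move=> /existsP[x /existsP[y /andP[A'x /allP Cx]]]; left.
  (* All letters of the class of [b], the first one included, become the variable. A letter of that
     class then gives a word equivalent to one of [A']; the other letters are covered by the sets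
     [C y c]. *)
  pose p : {ffun option J -> option L} :=
    fcons None (fun j => if q (x j) == q b then None else Some (x j)).
  have sp : subspace (fun z : word unit => fill p (z tt)).
    by apply: subspace_fill; exists None; rewrite ffunE.
  have sG := subspace_comp sF (subspace_mixl y (subspace_comp sSr sp)).
  eexists; first exact: sG.
  move=> z /=; set a := z tt.
  have fillE : fill p a = fcons a (repl x a).
    apply/ffunP => -[j|]; rewrite !ffunE ?ffunE //=.
    by case: ifP.
  rewrite fillE; case: (boolP (q a == q b)) => [/eqP ab|ab]; last first.
    by apply: Cx; rewrite mem_filter ab mem_enum.
  move: A'x; rewrite /A'; congr is_true; apply: qA1 => -[m|i]; rewrite !ffunE //.
  case: (S m) => // -[j|]; rewrite ?ffunE // ?ffunE //.
  by case: eqP => // ->.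
rewrite negb_exists => /forallP noline; right.
have A'1 : d' - e <= avg (fun y => dens R (A'^~ y)).
  rewrite /dens avg_exchange -(avg_const (d' - e) (w0 J)); apply: le_avg => x.
  exact: sec.
have C1 : th <= avg (fun y => dens R (fun x => all (C y ^~ x) s)).
  rewrite /dens avg_exchange -(avg_const th (w0 J)); apply: le_avg => x.
  (* The variable marks the letters of [x] in the class of [b]; filling with a letter [c] outside
     this class gives the word that defines [C y c]. *)
  pose u : {ffun J -> option L} := [ffun j => if q (x j) == q b then None else Some (x j)].
  apply: (le_trans (good u)); apply: le_dens => y /forallP By.
  apply/allP => c; rewrite mem_filter => /andP[cb _].
  move: (By c); rewrite fill_plug; congr (is_true (A1 (mix _ y))).
  apply/ffunP => m; rewrite !ffunE; case: (S m) => // -[j|]; rewrite ?ffunE /= ?ffunE.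
    by case: ifP => /=; rewrite /r ?(negbTE cb) // => ->.
  by rewrite /r (negbTE cb).
pose f (y : word I') (x : word J) : R := (A' x y)%:R - (d' + e).
have [y yP] : exists y, e < avg (fun x => f y x * (~~ all (C y ^~ x) s)%:R).
  have [] := @avg_exists R _ (e + e) (fun y => avg (fun x => f y x * (~~ all (C y ^~ x) s)%:R)).
  - exact: w0.
  - have -> : avg (fun y => avg (fun x => f y x * (~~ all (C y ^~ x) s)%:R)) =
        avg (fun y => dens R (A'^~ y)) -
        (d' + e) * (1 - avg (fun y => dens R (fun x => all (C y ^~ x) s))).
      rewrite -[X in _ * (X - _)](avg_const 1 (w0 I')) -avgB -avgZ -avgB.
      apply: eq_avg => y; rewrite -[X in _ * (X - _)](avg_const 1 (w0 J)) -avgB -avgZ -avgB.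
      apply: eq_avg => x; rewrite /f.
      have := noline x; rewrite negb_exists => /forallP/(_ y).
      by case: (A' x y); case: (all _ _) => //= _; ring.
    have th1 : th <= 1.
      have : d' <= 1 by apply: (le_trans dA); apply: dens_le1; exact: w0.
      lra.
    have : (d' + e) * (1 - avg (fun y => dens R (fun x => all (C y ^~ x) s))) <=
        (d' + e) * (1 - th).
      by apply: ler_wpM2l; lra.
    have : d * th <= d' * th by rewrite ler_pM2r.
    have : 0 <= e * th by rewrite mulr_ge0// ltW.
    have : e + e + e + e = d * th by rewrite /e; lra.
    lra.
  - by move=> y yP; exists y; lra.
(* Contrapositive of [tile_union]: some subspace of dimension [J0] has a positive average of [f y],
   hence a density of [A'] above [d' + e]. *)
have fN : ~ forall G : word J0 -> word J, subspace G -> avg (f y \o G) <= 0.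
  move=> fG; have [] := HJ (f y) (C y) _ (qC y) fG.
    move=> x; rewrite /f; have : (A' x y)%:R <= (1 : R) by rewrite lern1 leq_b1.
    lra.
  by rewrite leNgt yP.
case: (boolP [exists t : {ffun J -> L + J0}, allvars t && (0 < avg (f y \o app t))]).
  move=> /existsP[t /andP[tP ft]].
  have st : subspace (app t) by exists t.
  have sG := subspace_comp sF (subspace_mixl y
    (subspace_comp sSr (subspace_comp (subspace_fcons_const J b) st))).
  eexists; first exact: sG.
  move: ft; rewrite /f (avgB (fun x => (A' (app t x) y)%:R)) avg_const; last exact: w0.
  rewrite subr_gt0 => /ltW; exact.
rewrite negb_exists => /forallP nt; case: fN => G [t tP tG].
rewrite leNgt; have := nt t; rewrite tP /=; apply: contra => /lt_le_trans; apply.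
by apply: le_avg => x /=; rewrite tG.
Qed.

(** Outer induction on the number of classes; with one class, a nonempty measurable set is
    everything. The inner induction iterates the increment: [g] depends on [d] only through the
    initial lower bound, so the number of rounds is bounded in advance. *)
Lemma density_hales_jewett_q q : dhj R q.
Proof.
have [m qm] := ubnP #|codom q|; elim: m q qm => // m IHm q qm.
case: (pickP (fun p : L * L => q p.1 != q p.2)) => [[c0 b] /= cb|qq]; last first.
  move=> d d0; exists unit => A qA dA; have [x Ax] := dens_exists (w0 _) d0 dA.
  exists id; first exact: subspace_id.
  by move=> z; rewrite (qA z x) // => i; have /negbFE/eqP := qq (z i, x i).
have Hm c : q c != q b -> mdhj (identify q b c).
  rewrite eq_sym => bc; apply: (dhj_mdhj l0); apply: IHm.
  exact: leq_trans (card_identify bc) qm.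
move=> d d0; have [g g0 Hg] := density_increment cb Hm d0.
suff Ht t : exists I : finType, forall A : word I -> bool,
    qmeas q A -> d <= dens R A -> 1 - t%:R * g < dens R A ->
    exists2 F : word unit -> word I, subspace F & forall z, A (F z).
  have [I HI] := Ht (Num.bound g^-1); exists I => A qA dA; apply: HI => //.
  apply: lt_le_trans (dens_ge0 _ _).
  rewrite subr_lt0 -ltr_pdivrMr// mul1r; apply: archi_boundP.
  by rewrite invr_ge0 ltW.
elim: t => [|t [J HJ]].
  exists void => A _ _; rewrite mul0r subr0 ltNge => /negP; case.
  by apply: dens_le1; exact: w0.
have [I HI] := Hg J; exists I => A qA dA tA.
have [//|[F sF dF]] := HI A (dens R A) qA dA (lexx _).
have [|||G sG AG] := HJ (A \o F); first exact: qmeas_comp.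
- by apply: le_trans dF; lra.
- by apply: lt_le_trans dF; move: tA; rewrite -natr1; lra.
by exists (F \o G) => //; exact: subspace_comp.
Qed.

Theorem density_hales_jewett (d : R) : 0 < d -> exists I : finType,
  forall A : word I -> bool, d <= dens R A ->
  exists2 F : word unit -> word I, subspace F & forall z, A (F z).
Proof.
move=> /(density_hales_jewett_q id)[I HI]; exists I => A; apply: HI => x y xy.
by congr A; apply/ffunP.
Qed.

End Increment.

Local Close Scope ring_scope.

(** * Abelian subgroups of finite groups *)

Section LargeAbelianSubgroup.
Import GroupScope.
Local Open Scope nat_scope.

(** A maximal normal abelian subgroup [A] of a [p]-group is its own centralizer, so the quotient of
    [P] by [A] acts faithfully on [A] by conjugation and has order at most [n!]. *)
Lemma card_pgroup_le (gT : finGroupType) (p n : nat) (P : {group gT}) :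
  p.-group P -> (forall A : {group gT}, abelian A -> #|A| <= n) ->
  #|P| <= n * n`!.
Proof.
move=> pP abn.
have [A maxA] : {A : {group gT} | [max A | (normal A P) && abelian A]}.
  by apply: ex_maxgroup; exists 1%G; rewrite normal1 abelian1.
have /SCN_P[nAP cPA] := max_SCN pP maxA.
have abA : abelian A by have /maxgroupp/andP[] := maxA.
have An := abn _ abA.
have sPN := normal_norm nAP.
rewrite -(LagrangeI P 'C(A)) cPA; apply: leq_mul => //.
have -> : #|P : 'C(A)| = #|conj_aut A @* P|.
  by rewrite card_morphim ker_conj_aut (finset.setIidPr sPN).
apply: leq_trans (leq_fact An).
rewrite -(card_perm A) subset_leq_card //.
apply: fintype.subset_trans (Aut_conj_aut A P) _.
by apply/fintype.subsetP => a; rewrite inE => /andP[].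
Qed.

(** If all abelian subgroups have order at most [n], Cauchy's theorem bounds the primes dividing the
    order by [n], and the previous lemma bounds each Sylow subgroup. *)
Lemma large_abelian_subgroup (n : nat) : exists N : nat,
  forall gT : finGroupType, N <= #|gT| ->
  exists2 A : {group gT}, abelian A & n < #|A|.
Proof.
(* Taking [n.+1] keeps [B] positive when [n = 0]. *)
pose B := n.+1 * n.+1`!.
have B0 : 0 < B by rewrite muln_gt0 fact_gt0.
exists (B ^ n.+1).+1 => gT GN.
case: (boolP [exists A : {group gT}, abelian A && (n < #|A|)]).
  by move=> /existsP[A /andP[abA nA]]; exists A.
rewrite negb_exists => /forallP abn.
have {}abn (A : {group gT}) : abelian A -> #|A| <= n.
  by move=> abA; have := abn A; rewrite abA /= -leqNgt.
suff : #|gT| <= B ^ n.+1 by rewrite leqNgt GN.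
pose G := [set: gT]%G.
have -> : #|gT| = #|G| by rewrite cardsT.
have G0 : 0 < #|G| by exact: cardG_gt0.
have prn p : p \in primes #|G| -> p <= n.
  rewrite mem_primes => /and3P[pp _ pG].
  have [x _ <-] := Cauchy pp pG.
  exact: abn (cycle_abelian x).
rewrite [X in X <= _](prod_prime_decomp G0) prime_decompE big_map /=.
apply: (@leq_trans (\prod_(p <- primes #|G|) B)).
  rewrite big_seq [X in _ <= X]big_seq; apply: leq_prod => p pG.
  rewrite -p_part; have [S sylS] := Sylow_exists p G.
  rewrite -(card_Hall sylS); apply: leq_trans (card_pgroup_le (pHall_pgroup sylS) abn) _.
  by rewrite leq_mul// leq_fact.
rewrite big_const_seq count_predT iter_muln_1 leq_pexp2l//.
have -> : n.+1 = size (iota 0 n.+1) by rewrite size_iota.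
apply: uniq_leq_size; first exact: primes_uniq.
by move=> p /prn pn; rewrite mem_iota /= add0n ltnS.
Qed.

End LargeAbelianSubgroup.

(** * Families of group elements with nontrivial subset products *)

Section SubsetProducts.
Import GroupScope.

(** [h S] stands for the product over [S] of a commuting family; only its behaviour on disjoint
    unions and nonempty sets is retained. *)
Definition subset_prod (G : groupType) (I : finType) (h : {ffun I -> bool} -> G) : Prop :=
  (forall S T : {ffun I -> bool}, (forall i, ~~ (S i && T i)) ->
     h [ffun i => S i || T i] = h S * h T) /\
  (forall S : {ffun I -> bool}, (exists i, S i) -> h S <> 1).

(** Greedy choice: each new element avoids the inverses of the products of earlier ones, at most
    [2 ^ #|I|] elements of [A]. *)
Lemma abelian_subset_prod (gT : finGroupType) (A : {group gT}) (I : finType) :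
  abelian A -> (2 ^ #|I| < #|A|)%N ->
  exists h : {ffun I -> bool} -> gT, subset_prod h.
Proof.
move=> abA cardA.
pose pr (r : seq I) (f : I -> gT) (S : {ffun I -> bool}) := \prod_(i <- r) f i ^+ S i.
have prA r f S : (forall i, f i \in A) -> pr r f S \in A.
  by move=> fA; apply: group_prod => i _; rewrite groupX.
have [f [fA f1]] : exists f : I -> gT, (forall i, f i \in A) /\
    forall S : {ffun I -> bool}, has S (enum I) -> pr (enum I) f S <> 1.
  elim: (enum I) (enum_uniq I) => [_|e r IHr].
    by exists (fun=> 1); split => // i; exact: group1.
  rewrite /= => /andP[er /IHr[f [fA f1]]].
  have [g gA gN] : exists2 g, g \in A & g \notin codom (fun S => (pr r f S)^-1).
    apply/exists_inP; apply: contraLR cardA; rewrite negb_exists_in => /forall_inP gN.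
    rewrite -leqNgt; apply: (@leq_trans #|codom (fun S => (pr r f S)^-1)|).
      by apply: subset_leq_card; apply/fintype.subsetP => g /gN; rewrite negbK.
    by apply: leq_trans (leq_image_card _ _) _; rewrite card_ffun card_bool.
  exists (fun i => if i == e then g else f i); split.
    by move=> i; case: eqP.
  move=> S; have -> : pr (e :: r) (fun i => if i == e then g else f i) S =
      g ^+ S e * pr r f S.
    rewrite /pr big_cons eqxx; congr (_ * _); apply: eq_big_seq => i ir.
    by case: eqP => // ie; rewrite -ie ir in er.
  rewrite /=; case: (S e) => [_|]; last by rewrite mul1g; exact: f1.
  rewrite expg1 => /eqP; rewrite -eq_invg_mul => /eqP gS.
  move/negP: gN; apply; apply/codomP; exists S.
  by apply: (canRL (@invgK _)).
exists (pr (enum I) f); split; last first.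
  by move=> S [i Si]; apply: f1; apply/hasP; exists i; rewrite ?mem_enum.
move=> S T ST; elim: (enum I) => [|i r IHr].
  by rewrite /pr !big_nil mulg1.
have com : commute (f i ^+ T i) (pr r f S).
  by apply: (centsP abA); rewrite ?groupX ?prA.
move: IHr; rewrite /pr !big_cons => ->; rewrite -/(pr r f S) -/(pr r f T) ffunE.
rewrite -!mulgA (mulgA (pr r f S)) -com !mulgA; congr (_ * _ * _).
by rewrite -expgD; congr (_ ^+ _); have := ST i; case: (S i); case: (T i).
Qed.

(** An alias of [G] that the enumeration [e] makes a [finGroupType], so that the results on finite
    groups apply. *)
Definition fin_group (G : groupType) (e : seq G) (eP : Finite.axiom e) : Type := G.

Section FinGroup.
Variables (G : groupType) (e : seq G) (eP : Finite.axiom e).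
Local Notation T := (fin_group eP).

HB.instance Definition _ := Group.on T.

Let pickle (x : T) : nat := index (x : G) e.
Let unpickle (n : nat) : option T := onth e n.

Lemma fin_group_pickleK : pcancel pickle unpickle.
Proof.
move=> x; rewrite /unpickle /pickle onthE (nth_map (x : G)) ?nth_index //.
all: by rewrite ?index_mem -has_pred1 has_count eP.
Qed.

HB.instance Definition _ := Choice_isCountable.Build T fin_group_pickleK.
HB.instance Definition _ := fintype.isFinite.Build T (eP : Finite.axiom (e : seq T)).

End FinGroup.

Lemma exists_subset_prod (I : finType) : exists N : nat,
  forall (G : groupType) (e : seq G), Finite.axiom e -> (N <= size e)%N ->
  exists h : {ffun I -> bool} -> G, subset_prod h.
Proof.
have [N HN] := large_abelian_subgroup (2 ^ #|I|)%N; exists N => G e eP Ne.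
have [|A abA cardA] := HN (fin_group eP).
  by rewrite cardE enumT unlock.
exact: abelian_subset_prod abA cardA.
Qed.

End SubsetProducts.

(** * Cubes in dense subsets of compact groups *)

Local Open Scope classical_set_scope.
Local Open Scope card_scope.
Local Open Scope group_scope.

(** * Translations and averaging over the Haar measure *)

Lemma borel_preimage (G H : topologicalGroupType) (f : G -> H) (A : set (borel H)) :
  continuous f -> measurable A -> measurable (f @^-1` A : set (borel G)).
Proof.
move=> cf mA.
have mf : measurable_fun [set: borel G] (f : borel G -> borel H).
  have := @measurability _ _ (borel G) (borel H) setT f (@open (pointed_group H)) erefl.
  apply=> _ [U oU <-].
  by rewrite setTI; apply: sub_sigma_algebra; apply: open_comp.
by have := mf measurableT A mA; rewrite setTI.
Qed.

Lemma mulg_left_continuous (G : topologicalGroupType) (a : G) :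
  continuous (fun x : G => a * x).
Proof.
move=> x; apply: (@cvg_comp _ _ _ (fun z : G => (a, z))
  (fun z : G * G => z.1 * z.2) _ (nbhs (a, x))); last first.
  exact: (@mulg_continuous G (a, x)).
by apply: cvg_pair => /=; [exact: cvg_cst|exact: cvg_id].
Qed.

Lemma mulg_right_continuous (G : topologicalGroupType) (a : G) :
  continuous (fun x : G => x * a).
Proof.
move=> x; apply: (@cvg_comp _ _ _ (fun z : G => (z, a))
  (fun z : G * G => z.1 * z.2) _ (nbhs (x, a))); last first.
  exact: (@mulg_continuous G (x, a)).
by apply: cvg_pair => /=; [exact: cvg_id|exact: cvg_cst].
Qed.

Lemma measurable_translate (G : topologicalGroupType) (a : G) (A : set (borel G)) :
  measurable A -> measurable ((fun x : G => a * x) @^-1` A : set (borel G)).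
Proof. by move=> mA; apply: borel_preimage mA; exact: mulg_left_continuous. Qed.

Lemma haar_preimage (R : realType) (G : topologicalGroupType)
    (m : probability (borel G) R) (a : G) (A : set (borel G)) :
  haar m -> measurable A -> m ((fun x : G => a * x) @^-1` A) = m A.
Proof.
move=> hm mA; rewrite -(hm a^-1 A mA); congr (m _).
apply/seteqP; split => [x Ax|_ [x Ax <-]] /=; last by rewrite mulVKg.
by exists (a * x) => //; rewrite mulKg.
Qed.

(** Integrate over [x] the number of [w] with [p w * x] in [E]: by invariance each [w] contributes
    [m E]. The gap between [c] and [d] lets a non-strict comparison of integrals suffice. *)
Lemma haar_average (R : realType) (G : topologicalGroupType)
    (m : probability (borel G) R) (W : finType) (p : W -> G) (E : set (borel G))
    (c d : R) :
  haar m -> measurable E -> (0 <= c)%R -> (c < d)%R -> (d%:E <= m E)%E -> W ->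
  exists x : G, (c <= dens R (fun w => `[< E (p w * x)%g >]))%R.
Proof.
move=> hm mE c0 cd dE w0; apply: contrapT => /forallNP Ec.
pose T w : set (borel G) := (fun x : G => p w * x) @^-1` E.
have mT w : measurable (T w) by exact: measurable_translate.
have W0 : (0 < #|W|%:R :> R)%R by rewrite ltr0n; apply/card_gt0P; exists w0.
have : (\int[m]_x (\sum_(w <- enum W) (\1_(T w) x)%:E) <= \int[m]_x (c * #|W|%:R)%:E)%E.
  apply: ge0_le_integral => //=.
  - by move=> x _; apply: sume_ge0 => w _; rewrite lee_fin.
  - apply: emeasurable_sum => w; apply/measurable_EFinP.
    exact: measurable_indic.
  - move=> x _; rewrite sumEFin lee_fin.
    have := Ec x; move/negP; rewrite -ltNge /dens /avg ltr_pdivrMr// => /ltW.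
    apply: le_trans; rewrite big_enum /=; apply: ler_sum => w _.
    by rewrite indicE; exact: lexx.
rewrite integral_cst//. rewrite [X in (_ * X)%E](_ : _ = 1%E); last exact: probability_setT.
rewrite mule1 ge0_integral_sum//; last first.
  by move=> w; apply/measurable_EFinP; exact: measurable_indic.
have mEfin : m E = (fine (m E))%:E by rewrite fineK ?fin_num_measure.
rewrite (eq_bigr (fun=> (fine (m E))%:E)); last first.
  by move=> w _; rewrite integral_indic// setIT -mEfin; exact: haar_preimage.
rewrite sumEFin lee_fin big_enum /= sumr_const -(mulr_natr (fine (m E))) ler_pM2r//.
by rewrite mEfin lee_fin in dE; rewrite leNgt (lt_le_trans cd dE).
Qed.

Lemma finite_group_enum (G : topologicalGroupType) (N : nat) :
  finite_set [set: G] -> [set: 'I_N] #<= [set: G] ->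
  exists2 e : seq G, Finite.axiom e & (N <= size e)%N.
Proof.
move=> /finite_fsetP[X GX] NG.
have eT x : x \in enum_fset X by have : [set: G] x by []; rewrite GX.
exists (enum_fset X).
  apply: Finite.uniq_enumP => [|x]; first exact: fset_uniq.
  by rewrite eT.
have /pcard_injP[f finj] : [set: 'I_N] #<= [set: pointed_group G] by [].
rewrite -[leqLHS](size_enum_ord N) -(size_map (f : 'I_N -> G)).
apply: uniq_leq_size => [|x _]; last exact: eT.
by rewrite map_inj_uniq ?enum_uniq// => i j; apply: finj; rewrite inE.
Qed.

(* The words over [{0,1}^k] index a family of points of [G^k] for which every line
   is a cube; averaging over [x], some right translate [p w * x] of the family
   meets [E] in a dense set of words. *)
Lemma finite_cubes (R : realType) (delta : R) (k : nat) : (0 < delta)%R ->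
  exists N0 : nat, forall G : topologicalGroupType,
    finite_set [set: G] -> [set: 'I_N0] #<= [set: G] ->
  forall m : probability (borel (group_power G k)) R, haar m ->
  forall E : set (borel (group_power G k)),
    measurable E -> (delta%:E <= m E)%E ->
  exists (x : group_power G k) (g : G), g <> 1 /\
    forall eta : 'I_k -> bool, E (fun i => if eta i then g * x i else x i).
Proof.
move=> delta0; pose L := {ffun 'I_k -> bool}.
pose l0 : L := [ffun=> false].
have d20 : (0 < delta / 2)%R by rewrite divr_gt0.
have d2d : (delta / 2 < delta)%R by rewrite ltr_pdivrMr// mulr_natr mulr2n ltrDl.
have [I HI] := density_hales_jewett l0 d20.
have [N HN] := exists_subset_prod I.
exists N => G finG NG m hm E mE dE.
have [e eP Ne] := finite_group_enum finG NG.
have [h [hM h1]] := HN G e eP Ne.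
pose p (w : word L I) : group_power G k := fun i => h [ffun j => w j i].
have [x /HI[F [s sP sF] EF]] := haar_average p hm mE (ltW d20) d2d dE [ffun=> l0].
(* [S] is the wildcard set, and [T i] the set of fixed positions whose letter has [i]-th bit 1.
   Coordinate [i] of a point of the line is the product over [T i], or over the disjoint union of
   [S] and [T i], times [x i]. *)
pose S : {ffun I -> bool} := [ffun j => s j == inr tt].
pose T i : {ffun I -> bool} := [ffun j => if s j is inl a then a i else false].
exists (fun i => h (T i) * x i), (h S); split.
  by apply: h1; have /existsP[j sj] := forallP sP tt; exists j; rewrite ffunE.
move=> eta; have /asboolP := EF [ffun=> [ffun i => eta i]].
congr (E _); apply/funext => i.
rewrite [LHS]/(h [ffun j => F [ffun=> [ffun i => eta i]] j i] * x i).
have -> : [ffun j => F [ffun=> [ffun i => eta i]] j i] =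
    [ffun j => (eta i && S j) || T i j] :> {ffun I -> bool}.
  apply/ffunP => j; rewrite sF !ffunE; case: (s j) => [a|[]]; first by rewrite andbF.
  by rewrite !ffunE eqxx andbT orbF.
case: (eta i) => /=; last by congr (h _ * _); apply/ffunP => j; rewrite !ffunE.
rewrite hM ?mulgA// => j; rewrite !ffunE; by case: (s j).
Qed.

(** * Infinite compact groups *)

Lemma nonisolated_one (R : realType) (G : topologicalGroupType) (d : G -> G -> R) :
  compact [set: G] -> ~ finite_set [set: G] ->
  (forall (x : G) (A : set G),
    nbhs x A <-> exists2 e : R, (0 < e)%R & [set y | (d x y < e)%R] `<=` A) ->
  forall e : R, (0 < e)%R -> exists g : G, g <> 1 /\ (d 1%g g < e)%R.
Proof.
move=> cG infG dG e e0; apply: contrapT => /forallNP isol.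
(* If the identity is isolated, translation makes every singleton open, and compactness leaves
   finitely many points. *)
have n1 : nbhs (1 : G) [set 1].
  apply/dG; exists e => // y /= dy; apply: contrapT => y1.
  by apply: (isol y).
have o1 (x : G) : open [set x].
  rewrite openE => _ ->.
  have nx : nbhs x [set y | x^-1 * y = 1].
    by have := @mulg_left_continuous G x^-1 x [set 1]; rewrite mulVg => /(_ n1).
  suff : [set y | x^-1 * y = 1] `<=` [set x] by move/filterS; apply.
  by move=> y /= xy; rewrite -[y](mulKVg x) xy mulg1.
have cG' : @cover_compact (pointed_group G) setT by rewrite -compact_cover.
have := cG' G setT (fun x => [set x]).
case=> [x _|x _|D _ GD]; [exact: o1|by exists x|].
apply: infG; apply/finite_fsetP; exists D; apply/seteqP; split => // x _.
by have [y Dy /= ->] := GD x I.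
Qed.

Lemma measure_small (R : realType) (G : topologicalGroupType)
    (m : probability (borel G) R) (F : nat -> set (borel G)) (e : R) :
  (forall n, measurable (F n)) -> nonincreasing_seq F ->
  (forall x, exists n, ~ F n x) -> (0 < e)%R ->
  exists N, (m (F N) < e%:E)%E.
Proof.
move=> mF dF F0 e0.
have F00 : \bigcap_n F n = set0.
  by apply/seteqP; split => // x Fx; have [n] := F0 x; apply; exact: Fx.
have : m \o F @ \oo --> m (\bigcap_n F n).
  apply: nonincreasing_cvg_mu => //; last by rewrite F00.
  by rewrite (le_lt_trans (probability_le1 m (mF 0%N)))// ltry.
rewrite F00 measure0 => /(_ _ (@open_ereal_lt' R 0%E e%:E _)).
by case=> [|N _ /(_ N (leqnn _))]; [rewrite lte_fin|exists N].
Qed.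

(** * Continuity of translation in measure *)

Section Translates.
Variables (R : realType) (G : topologicalGroupType) (m : probability (borel G) R).
Hypothesis hm : haar m.
Variable b : nat -> G.
Hypothesis b1 : forall (x : G) (U : set G), nbhs x U ->
  exists N, forall n, (N <= n)%N -> U (b n * x).

Let T n (A : set (borel G)) : set (borel G) := (fun x : G => b n * x) @^-1` A.

Let mT n (A : set (borel G)) : measurable A -> measurable (T n A).
Proof. exact: measurable_translate. Qed.

Let hT n (A : set (borel G)) : measurable A -> m (T n A) = m A.
Proof. exact: haar_preimage. Qed.

Let stable (A : set (borel G)) : Prop := measurable A /\
  forall e : R, (0 < e)%R ->
    exists N, forall n, (N <= n)%N -> (m (A `\` T n A) <= e%:E)%E.

(** Each point of [U] eventually stays in [U] under [b n], so the sets of points that leave at some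
    time [n >= N] decrease to the empty set. *)
Let stable_open (U : set (borel G)) : open (U : set (pointed_group G)) -> stable U.
Proof.
move=> oU; have mU : measurable U by exact: sub_sigma_algebra.
split => // e e0.
pose F N : set (borel G) := \bigcup_(n in [set n | (N <= n)%N]) (U `\` T n U).
have mF N : measurable (F N).
  by apply: bigcup_measurable => n _; apply: measurableD => //; exact: mT.
have [||||N mN] := @measure_small R G m F e => //.
- move=> n n' nn'; apply/subsetPset => x [j /= n'j Fj]; exists j => //=.
  exact: leq_trans n'j.
- move=> x; case: (pselect (U x)) => [Ux|nUx]; last by exists 0%N => -[n _ []].
  have [|N HN] := @b1 x U; first by apply: open_nbhs_nbhs; split.
  by exists N => -[n /= Nn [_]]; apply; exact: HN.
- exists N => n Nn; apply: le_trans (ltW mN); apply: le_measure; rewrite ?inE //.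
    by apply: measurableD => //; exact: mT.
  by move=> x xU; exists n.
Qed.

Let stable0 : stable set0.
Proof. by split => // e e0; exists 0%N => n _; rewrite set0D measure0 lee_fin ltW. Qed.

(** By invariance [A] and [T n A] have equal measure, hence so do their two differences. *)
Let stableC (A : set (borel G)) : stable A -> stable (~` A).
Proof.
move=> [mA sA]; split; first exact: measurableC.
move=> e /sA[N HN]; exists N => n /HN; congr (_ <= _)%E.
have -> : ~` A `\` T n (~` A) = T n A `\` A.
  apply/seteqP; split=> [x [nA nTA]|x [TA nA]].
    by split => //; exact: contrapT.
  by split => // nTA; exact: nTA TA.
have fin (B : set (borel G)) : measurable B -> (m B < +oo)%E.
  by move=> mB; rewrite (le_lt_trans (probability_le1 m mB))// ltry.
rewrite (measureD (mT n mA) mA (fin _ (mT n mA))).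
rewrite (measureD mA (mT n mA) (fin _ mA)) [A `&` _]setIC.
by congr (_ - _)%E; exact/esym/hT.
Qed.

Let stableU (A B : set (borel G)) : stable A -> stable B -> stable (A `|` B).
Proof.
move=> [mA sA] [mB sB]; split; first exact: measurableU.
move=> e e0; have e2 : (0 < e / 2)%R by rewrite divr_gt0.
have [N HN] := sA _ e2; have [N' HN'] := sB _ e2.
exists (maxn N N') => n; rewrite geq_max => /andP[Nn N'n].
have mAn : measurable (A `\` T n A) by apply: measurableD => //; exact: mT.
have mBn : measurable (B `\` T n B) by apply: measurableD => //; exact: mT.
rewrite (splitr e) EFinD.
apply: le_trans (leeD (HN n Nn) (HN' n N'n)).
apply: le_trans (measureU2 m mAn mBn); apply: le_measure; rewrite ?inE.
- by apply: measurableD; [|apply: mT]; exact: measurableU.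
- exact: measurableU.
- move=> x [[Ax|Bx] nT]; [left|right]; split => // ?; apply: nT; [left|right] => //.
Qed.

(** A finite union [B J] exhausts the whole up to measure [e / 2], and is itself stable. *)
Let stable_bigcup (A : (set (borel G))^nat) :
  (forall n, stable (A n)) -> stable (\bigcup_n A n).
Proof.
move=> sA; have mA n : measurable (A n) by case: (sA n).
have mU : measurable (\bigcup_n A n) by exact: bigcupT_measurable.
split => // e e0; have e2 : (0 < e / 2)%R by rewrite divr_gt0.
pose B n := \big[setU/set0]_(j < n) A j.
have sB n : stable (B n).
  by rewrite /B; elim/big_ind: _ => //; exact: stableU.
have mB n : measurable (B n) by case: (sB n).
have BA n : B n `<=` \bigcup_n A n by exact: bigsetU_bigcup.
have [||||J mJ] := @measure_small R G m (fun n => \bigcup_n A n `\` B n) (e / 2)%R => //.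
- by move=> n; exact: measurableD.
- move=> n n' nn'; apply/subsetPset => x [Ax nB]; split => // Bx; apply: nB.
  by move: x Bx {Ax}; apply: subset_bigsetU.
- move=> x; case: (pselect ((\bigcup_n A n) x)) => [[j _ Aj]|nA]; last by exists 0%N => -[].
  exists j.+1 => -[_]; apply; rewrite /B big_ord_recr /=; by right.
have [_ /(_ _ e2)[N HN]] := sB J.
exists N => n Nn; rewrite (splitr e) EFinD.
apply: le_trans (leeD (ltW mJ) (HN n Nn)).
apply: le_trans (measureU2 m _ _); try by apply: measurableD => //; exact: mT.
apply: le_measure; rewrite ?inE.
- by apply: measurableD => //; exact: mT.
- by apply: measurableU; apply: measurableD => //; exact: mT.
- move=> x [Ax nT]; case: (pselect (B J x)) => [Bx|nB]; [right|left]; split => //.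
  by move=> /BA.
Qed.

(* The sets with this property form a sigma-algebra containing the open sets. *)
Lemma measure_translate_cvg (A : set (borel G)) (e : R) : measurable A -> (0 < e)%R ->
  exists N, forall n, (N <= n)%N ->
    (m (A `\` (fun x : G => (b n * x)%g) @^-1` A) <= e%:E)%E.
Proof.
move=> mA; suff : stable A by move=> [_]; exact.
move: A mA; apply: smallest_sub; last by move=> U; exact: stable_open.
by split => // A; rewrite setTD; exact: stableC.
Qed.

End Translates.

Lemma infinite_cubes (R : realType) (k : nat) (G : topologicalGroupType) :
  compact [set: G] -> metrizable R G -> ~ finite_set [set: G] ->
  forall m : probability (borel (group_power G k)) R, haar m ->
  forall E : set (borel (group_power G k)), measurable E -> (0 < m E)%E ->
  exists (x : group_power G k) (g : G), g <> 1 /\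
    forall eta : 'I_k -> bool, E (fun i => if eta i then g * x i else x i).
Proof.
move=> cG [d [_ _ _ _ dG]] infG m hm E mE E0.
have /choice[g gP] (n : nat) : exists g : G, g <> 1 /\ (d 1%g g < n.+1%:R^-1)%R.
  exact: nonisolated_one.
(* Translation by [b eta n] sends [x] to the vertex [eta] of its cube with step [g n]. *)
pose b (eta : {ffun 'I_k -> bool}) n : group_power G k :=
  fun i => if eta i then g n else 1.
have bE eta n (x : group_power G k) i :
    (b eta n * x) i = if eta i then g n * x i else x i.
  transitivity ((if eta i then g n else 1 : G) * x i) => //.
  by case: ifP => // _; exact: mul1g.
have b1 eta (x : group_power G k) (U : set (group_power G k)) : nbhs x U ->
    exists N, forall n, (N <= n)%N -> U (b eta n * x).
  (* Continuity of this map at the identity shows that [b eta n * x] tends to [x]. *)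
  pose act (t : G) : group_power G k := fun i => if eta i then t * x i else x i.
  have cact : continuous act.
    apply: group_power_continuous => i; rewrite /act.
    case: (eta i); first exact: mulg_right_continuous.
    by move=> t; exact: cvg_cst.
  have act1 : act 1 = x by apply/funext => i; rewrite /act mul1g if_same.
  have actb n : act (g n) = b eta n * x.
    by apply/funext => i; rewrite bE.
  move=> xU; have : nbhs (act 1) U by rewrite act1.
  move=> /(cact 1)/dG[e e0 eU].
  exists (Num.bound e^-1) => n Nn; rewrite -actb; apply: eU => /=.
  have [_ /lt_trans] := gP n; apply.
  rewrite invf_plt ?posrE//.
  apply: (lt_trans (archi_boundP _)); first by rewrite invr_ge0 ltW.
  by rewrite ltr_nat ltnS.
pose T eta n : set (borel (group_power G k)) := (fun x => b eta n * x) @^-1` E.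
have mT eta n : measurable (T eta n) by exact: measurable_translate.
have [N HN] : exists N, exists x, E x /\
    forall eta, eta \in enum {ffun 'I_k -> bool} -> T eta N x.
  (* Union bound over the vertices: [B] contains the points of [E] with a listed vertex outside [E].
     With half the measure of [E] as allowance, [B] cannot cover [E]. *)
  suff Hs (s : seq {ffun 'I_k -> bool}) (e : R) : (0 < e)%R -> exists N,
      forall n, (N <= n)%N -> exists2 B : set (borel (group_power G k)),
        measurable B /\ (m B <= e%:E)%E &
        forall x, E x -> ~ B x -> forall eta, eta \in s -> T eta n x.
    have Efin : m E = (fine (m E))%:E by rewrite fineK ?fin_num_measure.
    have e0 : (0 < fine (m E) / 2)%R.
      by rewrite divr_gt0// -lte_fin -Efin.
    have [N /(_ N (leqnn N))[B [mB Be] BE]] :=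
      Hs (enum {ffun 'I_k -> bool}) _ e0.
    exists N; apply: contrapT => /forallNP nE.
    have : (m E <= m B)%E.
      apply: le_measure; rewrite ?inE// => x Ex; apply: contrapT => nB.
      by apply: (nE x); split => // eta etaE; exact: BE.
    move=> /le_trans/(_ Be); rewrite Efin lee_fin leNgt ltr_pdivrMr//.
    by rewrite mulr_natr mulr2n ltrDl -lte_fin -Efin E0.
  elim: s e => [|eta s IHs] e e0.
    by exists 0%N => n _; exists set0 => //; rewrite measure0 lee_fin ltW.
  have e2 : (0 < e / 2)%R by rewrite divr_gt0.
  have [N HN] := IHs _ e2.
  have [N' HN'] := measure_translate_cvg hm (b1 eta) mE e2.
  exists (maxn N N') => n; rewrite geq_max => /andP[/HN[B [mB Be] BE] /HN' En].
  have mD : measurable (E `\` T eta n) by exact: measurableD.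
  exists (B `|` (E `\` T eta n)).
    split; first exact: measurableU.
    by apply: le_trans (measureU2 m mB mD) _; rewrite (splitr e) EFinD leeD.
  move=> x Ex nB eta'; rewrite inE => /orP[/eqP ->|].
    by apply: contrapT => nT; apply: nB; right.
  by apply: BE => // Bx; apply: nB; left.
have [x [Ex Tx]] := HN.
exists x, (g N); split; first by have [] := gP N.
move=> eta; have := Tx [ffun i => eta i]; rewrite mem_enum => /(_ isT).
by congr (E _); apply/funext => i; rewrite bE ffunE.
Qed.

Theorem theoremA (R : realType) (delta : R) (k : nat) (delta_gt0 : (0 < delta)%R) :
  exists N0 : nat,
  forall G : topologicalGroupType,
    compact [set: G] -> metrizable R G -> [set: 'I_N0] #<= [set: G] ->
  forall m : probability (borel (group_power G k)) R, haar m ->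
  forall E : set (borel (group_power G k)),
    measurable E -> (delta%:E <= m E)%E ->
  exists (x : group_power G k) (g : G), g <> 1 /\
    [set (fun i : 'I_k => if eta i then g * x i else x i)
       | eta in [set: 'I_k -> bool]] `<=` E.
Proof.
have [N0 HN0] := finite_cubes k delta_gt0.
exists N0 => G cG metG NG m hm E mE dE.
have [x [g [g1 xE]]] : exists (x : group_power G k) (g : G), g <> 1 /\
    forall eta : 'I_k -> bool, E (fun i => if eta i then g * x i else x i).
  case: (pselect (finite_set [set: G])) => finG; first exact: (HN0 G finG NG m).
  apply: (infinite_cubes cG metG finG hm mE).
  by apply: lt_le_trans dE; rewrite lte_fin.
by exists x, g; split => // _ [eta _ <-].
Qed.
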